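(* Let $\Gamma$ be a finite program (rules may contain aggregate expressions in their bodies). Then every stable model of $\Gamma$ satisfies the completion of $\Gamma$.
   Context: Syntax. Fix pairwise disjoint sets of numerals, symbolic constants, variables, operation names (each with an arity) and aggregate names, not containing the special symbols $\mathit{inf}$, $\mathit{sup}$, $\mathit{not}$, $..$, the relation symbols $=,\neq,<,>,\le,\ge$, or logical symbols. There is a fixed bijection $n\mapsto\overline n$ from $\mathbb Z$ onto the numerals. Each $n$-ary operation name $\mathit{op}$ has a function $\widehat{\mathit{op}}$ from a subset of $\mathbb Z^n$ to $\mathbb Z$; each aggregate name $\alpha$ has a function $\widehat\alpha$ mapping every set of non-empty tuples of precomputed terms to a precomputed term. Terms: numerals, symbolic constants, variables, $\mathit{inf}$, $\mathit{sup}$; $f(\mathbf t)$ for a symbolic constant $f$ and a non-empty tuple of terms $\mathbf t$; $\mathit{op}(\mathbf t)$ for an $n$-ary operation name and an $n$-tuple of terms; $(t_1..t_2)$ for terms $t_1,t_2$. A term is ground if it has no variables, precomputed if it is ground and contains neither operation names nor $..$. A fixed total order on precomputed terms has $\mathit{inf}$ least, $\mathit{sup}$ greatest, and $\overline m\le\overline n$ iff $m\le n$; relation symbols are interpreted on precomputed terms via this order ($=$ is identity). The set $[t]$ of values of a ground term: $[t]=\{t\}$ for a numeral, symbolic constant, $\mathit{inf}$, $\mathit{sup}$; $[f(t_1,\dots,t_n)]=\{f(r_1,\dots,r_n): r_i\in[t_i]\}$; $[\mathit{op}(t_1,\dots,t_n)]$ is the set of numerals $\overline{\widehat{\mathit{op}}(k_1,\dots,k_n)}$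 for $(k_1,\dots,k_n)$ in the domain of $\widehat{\mathit{op}}$ with $\overline{k_i}\in[t_i]$; $[(t_1..t_2)]$ is the set of numerals $\overline m$ such that $k_1\le m\le k_2$ for some $\overline{k_1}\in[t_1],\overline{k_2}\in[t_2]$. For tuples, $[t_1,\dots,t_n]$ is the set of tuples $r_1,\dots,r_n$ with $r_i\in[t_i]$. An atom is $p(\mathbf t)$ with $p$ a symbolic constant and $\mathbf t$ a possibly empty tuple of terms; a literal is an atom or $\mathit{not}\ A$ for an atom $A$; a comparison is $(t_1\prec t_2)$ with $\prec$ a relation symbol; an aggregate expression is $\alpha\{\mathbf t:\mathbf C\}\prec s$ with $\mathbf t$ a non-empty tuple of terms, $\mathbf C$ a conjunction of literals and comparisons, and $s$ a variable or precomputed term. A rule is $\mathit{Head}\leftarrow\mathit{Body}$ where $\mathit{Body}$ is a (possibly empty) conjunction of literals, comparisons and aggregate expressions, and $\mathit{Head}$ is an atom (basic rule), an expression $\{A\}$ with $A$ an atom (choice rule), or empty (constraint). A program is a set of rules. A variable of a rule is local if every occurrence of it lies in the left-hand part $\alpha\{\mathbf t:\mathbf C\}$ of an aggregate expression in the body, and global otherwise. A predicate symbol is a pair $p/n$; it occurs in an expression if the expression contains an atom $p(t_1,\dots,t_n)$. The vocabulary of a program is the set of atoms $p(\mathbf r)$ with $\mathbf r$ an $n$-tuple of precomputed terms and $p/n$ occurring in it. An interpretation is a set of atoms $p(\mathbf r)$ with $\mathbf r$ a tuple of precomputed terms. Formulas and arguments (mutually recursive): (a) $p(\mathbf{arg})$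 for a symbolic constant $p$ and tuple of arguments; (b) $(\mathit{arg}_1\prec\mathit{arg}_2)$; (c) $\mathit{arg}\in t$ for an argument and a term $t$; (d) $\bot$; (e) $F\to G$; (f) $\forall X F$ are formulas; (g) numerals, symbolic constants, variables, $\mathit{inf}$, $\mathit{sup}$; (h) $f(\mathbf{arg})$ for a symbolic constant $f$ and non-empty tuple of arguments; (i) $\alpha\{\mathbf X\mid F\}$ for an aggregate name, non-empty tuple $\mathbf X$ of distinct variables, and formula $F$, are arguments. Other connectives and $\exists$ are the usual abbreviations. Occurrences of $X$ are bound if inside $\forall XF$ or inside $\alpha\{\mathbf X\mid F\}$ with $X$ in $\mathbf X$. For an interpretation $\mathcal I$, closed formulas get truth values and closed arguments get precomputed terms: $p(\mathit{arg}_1,..,\mathit{arg}_k)$ is true iff $p(\mathit{arg}_1^{\mathcal I},\dots,\mathit{arg}_k^{\mathcal I})\in\mathcal I$; $\mathit{arg}_1\prec\mathit{arg}_2$ is true iff $\mathit{arg}_1^{\mathcal I}\prec\mathit{arg}_2^{\mathcal I}$; $\mathit{arg}\in t$ is true iff $\mathit{arg}^{\mathcal I}\in[t]$; $\bot$ false; $\to$ classical; $\forall XF$ true iff $F^X_r$ is true for every precomputed term $r$; numerals, symbolic constants, $\mathit{inf},\mathit{sup}$ denote themselves; $f(\dots)^{\mathcal I}=f(\mathit{arg}_1^{\mathcal I},\dots)$; $\alpha\{X_1,\dots,X_k\mid F\}^{\mathcal I}=\widehat\alpha(T)$ where $T$ is the set of tuples $r_1,\dots,r_k$ of precomputed terms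 with $F^{X_1\dots X_k}_{r_1\dots r_k}$ true. Formula representation. $\phi\,p(\mathbf t)=\exists\mathbf X(\mathbf X\in\mathbf t\wedge p(\mathbf X))$; $\phi(\mathit{not}\ p(\mathbf t))=\exists\mathbf X(\mathbf X\in\mathbf t\wedge\neg p(\mathbf X))$; $\phi(t_1\prec t_2)=\exists X_1X_2(X_1\in t_1\wedge X_2\in t_2\wedge X_1\prec X_2)$, with new variables ($\mathbf X\in\mathbf t$ is the conjunction of the componentwise memberships). For a list $\mathbf X$ of distinct variables, $\phi^{\mathbf X}$ equals $\phi$ on literals and comparisons, and maps the aggregate expression $\alpha\{\mathbf t:\mathbf C\}\prec s$ to $\exists Y(\alpha\{\mathbf Z\mid\exists\mathbf X(\mathbf Z\in\mathbf t\wedge\phi\mathbf C)\}\prec Y\wedge Y\in s)$ with new $\mathbf Z,Y$; on conjunctions it acts conjunct-wise. With $\mathbf X$ the local variables of the rule and $\mathbf V$ new variables: a basic rule $p(\mathbf t)\leftarrow\mathit{Body}$ is represented by $\mathbf V\in\mathbf t\wedge\phi^{\mathbf X}(\mathit{Body})\to p(\mathbf V)$; a choice rule $\{p(\mathbf t)\}\leftarrow\mathit{Body}$ by $\mathbf V\in\mathbf t\wedge\phi^{\mathbf X}(\mathit{Body})\wedge p(\mathbf V)\to p(\mathbf V)$; a constraint $\leftarrow\mathit{Body}$ by $\neg\phi^{\mathbf X}(\mathit{Body})$. Completion. The definition of $p/n$ in $\Gamma$ consists of the basic rules of $\Gamma$ with head $p(t_1,\dots,t_n)$ and the choice rules with head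 $\{p(t_1,\dots,t_n)\}$. If it is $\{R_1,\dots,R_k\}$, write the representation of $R_i$ as $F_i\to p(\mathbf V)$ with the same tuple $\mathbf V$ of distinct variables for all $i$; the completed definition of $p/n$ is $\forall\mathbf V(p(\mathbf V)\leftrightarrow\bigvee_{i=1}^k\exists\mathbf U_iF_i)$, where $\mathbf U_i$ lists the free variables of $F_i$ not in $\mathbf V$. The completion of a finite program $\Gamma$ consists of the completed definitions of all predicate symbols occurring in $\Gamma$ and the universal closures of the formula representations of all constraints of $\Gamma$. Stable models. Infinitary formulas over a set of atoms: atoms, $\bot$, $\mathcal H^\wedge$ and $\mathcal H^\vee$ for any set $\mathcal H$ of infinitary formulas, and $G\to H$; $\neg F$ is $F\to\bot$, $\top$ is $\bot\to\bot$; satisfaction is classical. The reduct $F^{\mathcal I}$ is $\bot$ if $\mathcal I\not\models F$, and otherwise: $A$ for an atom $A$; $\{G^{\mathcal I}:G\in\mathcal H\}^\wedge$ resp. $^\vee$ for $\mathcal H^\wedge$, $\mathcal H^\vee$; $G^{\mathcal I}\to H^{\mathcal I}$ for $G\to H$. $\mathcal I$ is a stable model of $F$ if it is a minimal (w.r.t. inclusion) set of atoms satisfying $F^{\mathcal I}$. Translation $\tau$: for a ground atom, $\tau p(\mathbf t)=\bigvee_{\mathbf r\in[\mathbf t]}p(\mathbf r)$; $\tau(\mathit{not}\ p(\mathbf t))=\bigvee_{\mathbf r\in[\mathbf t]}\neg p(\mathbf r)$; for a ground comparison, $\tau(t_1\prec t_2)$ is $\top$ if $r_1\prec r_2$ for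 some $r_1\in[t_1],r_2\in[t_2]$, else $\bot$. An aggregate expression $E=\alpha\{\mathbf t:\mathbf C\}\prec s$ is closed if $s$ is ground; let $\mathbf X$ list its variables, $A$ the set of tuples of precomputed terms of length $|\mathbf X|$, and for $\Delta\subseteq A$ let $[\Delta]=\bigcup_{\mathbf r\in\Delta}[\mathbf t^{\mathbf X}_{\mathbf r}]$; $\Delta$ justifies $E$ if $\widehat\alpha([\Delta])\prec s$. Then $\tau E$ is the conjunction, over all $\Delta\subseteq A$ not justifying $E$, of $\bigwedge_{\mathbf r\in\Delta}\tau(\mathbf C^{\mathbf X}_{\mathbf r})\to\bigvee_{\mathbf r\in A\setminus\Delta}\tau(\mathbf C^{\mathbf X}_{\mathbf r})$. $\tau$ acts conjunct-wise on conjunctions. A rule is closed if all its variables are local; for closed rules: $\tau(p(\mathbf t)\leftarrow\mathit{Body})=\tau(\mathit{Body})\to\bigwedge_{\mathbf r\in[\mathbf t]}p(\mathbf r)$; $\tau(\{p(\mathbf t)\}\leftarrow\mathit{Body})=\tau(\mathit{Body})\to\bigwedge_{\mathbf r\in[\mathbf t]}(p(\mathbf r)\vee\neg p(\mathbf r))$; $\tau(\leftarrow\mathit{Body})=\neg\tau(\mathit{Body})$. An instance of a rule is the closed rule obtained by substituting precomputed terms for its global variables. $\tau\Gamma$ is the conjunction of $\tau R$ over all instances $R$ of rules of $\Gamma$, and the stable models of $\Gamma$ are the stable models of $\tau\Gamma$ (as sets of atoms from the vocabulary of $\Gamma$). *)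

(* Defs.v *)
From Stdlib Require List.
From mathcomp Require Import all_boot order ssralg ssrnum ssrint.
From mathcomp Require Import boolp classical_sets.
Set Implicit Arguments.
Unset Strict Implicit.
Unset Printing Implicit Defensive.
Local Open Scope classical_set_scope.

(* Non-empty tuples of unspecified length. *)
Definition ntuple (T : Type) : Type := (T * seq T)%type.
Definition ntuple_seq (T : Type) (s : ntuple T) : seq T := s.1 :: s.2.

(* Numerals are identified with the integers they represent (constructors TNum,
   PNum and ANum below), so the numerals need no field here. The partial
   function attached to an operation name is rendered with [option]. *)
Record signature := Signature {
  sym : eqType;
  var : choiceType;
  var_infinite : forall s : seq var, exists x, x \notin s;
  opname : Type;
  arity : opname -> nat;
  op_fun : forall o : opname, ('I_(arity o) -> int) -> option int;
  aggname : Type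
}.

Inductive relsym := REq | RNeq | RLt | RGt | RLe | RGe.

Section Syntax.
Variable S : signature.

Definition fresh (s : seq (var S)) : var S := xchoose (var_infinite s).

(* [n] distinct variables, none of them in [s]. *)
Fixpoint freshn (n : nat) (s : seq (var S)) : seq (var S) :=
  if n is n'.+1 then let x := fresh s in x :: freshn n' (x :: s) else [::].

Lemma fresh_notin s : fresh s \notin s.
Proof. exact: (xchooseP (var_infinite s)). Qed.

Lemma freshn_uniq n s :
  uniq (freshn n s) && all (fun x => x \notin s) (freshn n s).
Proof.
elim: n s => //= n IHn s; have /andP[-> a] := IHn (fresh s :: s).
rewrite fresh_notin andbT /=; apply/andP; split.
  by apply/negP => /(allP a); rewrite inE eqxx.
by apply/allP => x /(allP a); rewrite inE negb_or => /andP[].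
Qed.

Lemma freshS_uniq n s :
  uniq (fresh s :: freshn n (fresh s :: s)).
Proof. by have /andP[] := freshn_uniq n.+1 s. Qed.

Inductive term : Type :=
| TNum of int
| TSym of sym S
| TVar of var S
| TInf
| TSup
| TFun of sym S & term & seq term (* the tuple of arguments is non-empty *)
| TOp (o : opname S) of ('I_(arity o) -> term)
| TInt of term & term.

(* Precomputed terms: the ground terms without operation names and [..],
   as a type of its own, embedded into terms by [term_of]. *)
Inductive pterm : Type :=
| PNum of int
| PSym of sym S
| PInf
| PSup
| PFun of sym S & pterm & seq pterm.

Fixpoint term_of (r : pterm) : term :=
  match r with
  | PNum k => TNum k
  | PSym c => TSym c
  | PInf => TInf
  | PSup => TSup
  | PFun f r rs => TFun f (term_of r) (map term_of rs)
  end.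

(* The set of tuples [r1, ..., rn] with each [ri] in [V ti]. *)
Definition tuple_values (A B : Type) (V : A -> set B) :=
  fix vals (ts : seq A) : set (seq B) :=
    if ts is t :: ts' then [set r :: rs | r in V t & rs in vals ts']
    else [set [::]].

(* Meaningful for ground terms only; a variable gets the dummy value set0. *)
Fixpoint values (t : term) : set pterm :=
  match t with
  | TNum k => [set PNum k]
  | TSym c => [set PSym c]
  | TVar _ => set0
  | TInf => [set PInf]
  | TSup => [set PSup]
  | TFun f t ts =>
      [set PFun f r rs | r in values t & rs in tuple_values values ts]
  | TOp o ts =>
      [set v | exists (k : 'I_(arity o) -> int) (m : int),
         [/\ forall i, values (ts i) (PNum (k i)),
             op_fun k = Some m & v = PNum m]]
  | TInt t1 t2 =>
      [set v | exists k1 k2 m : int,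
         [/\ values t1 (PNum k1), values t2 (PNum k2),
             ((k1 <= m) && (m <= k2))%R & v = PNum m]]
  end.

(* [p(t1, ..., tn)] is the pair of [p] and [t1, ..., tn]. *)
Definition atom : Type := (sym S * seq term)%type.
Definition patom : Type := (sym S * seq pterm)%type.

Inductive literal :=
| LPos of atom
| LNeg of atom.

Inductive condition :=
| CLit of literal
| CCmp of relsym & term & term.

Inductive rhs :=
| RVar of var S
| RPre of pterm.

Record aggexp := AggExp {
  agg_name : aggname S;
  agg_tuple : ntuple term;
  agg_cond : seq condition;
  agg_rel : relsym;
  agg_rhs : rhs
}.

Inductive conjunct :=
| BCond of condition
| BAgg of aggexp.

Inductive rule_head :=
| HBasic of atom
| HChoice of atom
| HNone.

Record rule := Rule { head : rule_head; body : seq conjunct }.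

Definition program := set rule.

Definition program_of (l : seq rule) : program := [set R | List.In R l].

Fixpoint term_vars (t : term) : seq (var S) :=
  match t with
  | TVar x => [:: x]
  | TFun _ t ts => term_vars t ++ flatten (map term_vars ts)
  | TOp o ts => flatten [seq term_vars (ts i) | i <- enum 'I_(arity o)]
  | TInt t1 t2 => term_vars t1 ++ term_vars t2
  | _ => [::]
  end.

Definition tuple_vars (ts : seq term) := flatten (map term_vars ts).

Definition literal_atom (L : literal) : atom :=
  match L with LPos A => A | LNeg A => A end.

Definition cond_vars (c : condition) : seq (var S) :=
  match c with
  | CLit L => tuple_vars (literal_atom L).2
  | CCmp _ t1 t2 => term_vars t1 ++ term_vars t2
  end.

Definition rhs_vars (s : rhs) : seq (var S) :=
  if s is RVar x then [:: x] else [::].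

Definition agg_left_vars (E : aggexp) : seq (var S) :=
  tuple_vars (ntuple_seq (agg_tuple E)) ++ flatten (map cond_vars (agg_cond E)).

Definition agg_vars (E : aggexp) : seq (var S) :=
  agg_left_vars E ++ rhs_vars (agg_rhs E).

Definition conjunct_vars (B : conjunct) : seq (var S) :=
  match B with BCond c => cond_vars c | BAgg E => agg_vars E end.

Definition head_atoms (H : rule_head) : seq atom :=
  match H with HBasic A => [:: A] | HChoice A => [:: A] | HNone => [::] end.

Definition head_vars (H : rule_head) : seq (var S) :=
  flatten [seq tuple_vars A.2 | A <- head_atoms H].

Definition rule_vars (R : rule) : seq (var S) :=
  head_vars (head R) ++ flatten (map conjunct_vars (body R)).

(* The variables with an occurrence outside the left-hand parts of the
   aggregate expressions. *)
Definition global_vars (R : rule) : seq (var S) :=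
  head_vars (head R) ++
  flatten [seq match B with
               | BCond c => cond_vars c
               | BAgg E => rhs_vars (agg_rhs E)
               end | B <- body R].

Definition local_vars (R : rule) : seq (var S) :=
  undup [seq x <- rule_vars R | x \notin global_vars R].

Definition cond_atoms (c : condition) : seq atom :=
  if c is CLit L then [:: literal_atom L] else [::].

Definition conjunct_atoms (B : conjunct) : seq atom :=
  match B with
  | BCond c => cond_atoms c
  | BAgg E => flatten (map cond_atoms (agg_cond E))
  end.

Definition rule_atoms (R : rule) : seq atom :=
  head_atoms (head R) ++ flatten (map conjunct_atoms (body R)).

Definition occurs (Gamma : program) (p : sym S) (n : nat) : Prop :=
  exists R A, [/\ Gamma R, List.In A (rule_atoms R), A.1 = p & size A.2 = n].

Definition vocabulary (Gamma : program) : set patom :=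
  [set A | occurs Gamma A.1 (size A.2)].

Definition substitution := var S -> option pterm.

Definition subst_empty : substitution := fun=> None.

(* [s], updated by mapping the i-th variable of [xs] to the i-th term of [rs]
   (the lengths are equal wherever this is used). *)
Definition subst_upd (s : substitution) (xs : seq (var S)) (rs : seq pterm)
    : substitution :=
  fun y => if y \in xs then Some (nth PInf rs (index y xs)) else s y.

Fixpoint term_subst (s : substitution) (t : term) : term :=
  match t with
  | TVar x => if s x is Some r then term_of r else TVar x
  | TFun f t ts => TFun f (term_subst s t) (map (term_subst s) ts)
  | TOp o ts => TOp (fun i => term_subst s (ts i))
  | TInt t1 t2 => TInt (term_subst s t1) (term_subst s t2)
  | _ => t
  end.

Definition atom_subst (s : substitution) (A : atom) : atom :=
  (A.1, map (term_subst s) A.2).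

Definition cond_subst (s : substitution) (c : condition) : condition :=
  match c with
  | CLit (LPos A) => CLit (LPos (atom_subst s A))
  | CLit (LNeg A) => CLit (LNeg (atom_subst s A))
  | CCmp q t1 t2 => CCmp q (term_subst s t1) (term_subst s t2)
  end.

Definition rhs_subst (s : substitution) (u : rhs) : rhs :=
  match u with
  | RVar x => if s x is Some r then RPre r else RVar x
  | RPre r => RPre r
  end.

Definition agg_subst (s : substitution) (E : aggexp) : aggexp :=
  AggExp (agg_name E)
    (term_subst s (agg_tuple E).1, map (term_subst s) (agg_tuple E).2)
    (map (cond_subst s) (agg_cond E)) (agg_rel E) (rhs_subst s (agg_rhs E)).

Definition conjunct_subst (s : substitution) (B : conjunct) : conjunct :=
  match B with
  | BCond c => BCond (cond_subst s c)
  | BAgg E => BAgg (agg_subst s E)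
  end.

Definition head_subst (s : substitution) (H : rule_head) : rule_head :=
  match H with
  | HBasic A => HBasic (atom_subst s A)
  | HChoice A => HChoice (atom_subst s A)
  | HNone => HNone
  end.

Definition rule_subst (s : substitution) (R : rule) : rule :=
  Rule (head_subst s (head R)) (map (conjunct_subst s) (body R)).

Definition is_instance (R R' : rule) : Prop :=
  exists r : var S -> pterm,
    R' = rule_subst
           (fun x => if x \in global_vars R then Some (r x) else None) R.

Inductive formula : Type :=
| FAtom of sym S & seq arg
| FRel of relsym & arg & arg
| FIn of arg & term
| FBot
| FImp of formula & formula
| FAll of var S & formula
with arg : Type :=
| ANum of int
| ASym of sym S
| AVar of var S
| AInf
| ASup
| AFun of sym S & arg & seq arg (* the tuple of arguments is non-empty *)
| AAgg (al : aggname S) (Xs : ntuple (var S)) (_ : uniq (ntuple_seq Xs))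
    (F : formula).

Definition FNeg F := FImp F FBot.
Definition FTop := FNeg FBot.
Definition FAnd F G := FNeg (FImp F (FNeg G)).
Definition FOr F G := FImp (FNeg F) G.
Definition FIff F G := FAnd (FImp F G) (FImp G F).
Definition FEx x F := FNeg (FAll x (FNeg F)).
Definition FAnds (Fs : seq formula) := foldr FAnd FTop Fs.
Definition FOrs (Fs : seq formula) := foldr FOr FBot Fs.
Definition FAlls (xs : seq (var S)) F := foldr FAll F xs.
Definition FExs (xs : seq (var S)) F := foldr FEx F xs.

Fixpoint free_vars (F : formula) : seq (var S) :=
  match F with
  | FAtom _ args => flatten (map arg_free_vars args)
  | FRel _ a1 a2 => arg_free_vars a1 ++ arg_free_vars a2
  | FIn a t => arg_free_vars a ++ term_vars t
  | FBot => [::]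
  | FImp F G => free_vars F ++ free_vars G
  | FAll x F => [seq y <- free_vars F | y != x]
  end
with arg_free_vars (a : arg) : seq (var S) :=
  match a with
  | AVar x => [:: x]
  | AFun _ a args => arg_free_vars a ++ flatten (map arg_free_vars args)
  | AAgg _ Xs _ F => [seq y <- free_vars F | y \notin ntuple_seq Xs]
  | _ => [::]
  end.

Definition universal_closure (F : formula) : formula :=
  FAlls (undup (free_vars F)) F.

(* In the formula representations, [av] lists the variables to be avoided by
   the new variables. *)

Definition FIns (Xs : seq (var S)) (ts : seq term) : formula :=
  FAnds [seq FIn (AVar Xt.1) Xt.2 | Xt <- zip Xs ts].

Definition phi_cond (av : seq (var S)) (c : condition) : formula :=
  match c with
  | CLit (LPos A) =>
      let Xs := freshn (size A.2) av in
      FExs Xs (FAnd (FIns Xs A.2) (FAtom A.1 (map AVar Xs)))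
  | CLit (LNeg A) =>
      let Xs := freshn (size A.2) av in
      FExs Xs (FAnd (FIns Xs A.2) (FNeg (FAtom A.1 (map AVar Xs))))
  | CCmp q t1 t2 =>
      let X1 := fresh av in
      let X2 := fresh (X1 :: av) in
      FExs [:: X1; X2]
        (FAnd (FIn (AVar X1) t1)
           (FAnd (FIn (AVar X2) t2) (FRel q (AVar X1) (AVar X2))))
  end.

Definition rhs_term (s : rhs) : term :=
  match s with RVar x => TVar x | RPre r => term_of r end.

Definition phi_agg (av Xs : seq (var S)) (E : aggexp) : formula :=
  let Y := fresh av in
  let Z := fresh (Y :: av) in
  let Zs := freshn (size (agg_tuple E).2) (Z :: Y :: av) in
  let C := FExs Xs
    (FAnd (FIns (Z :: Zs) (ntuple_seq (agg_tuple E)))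
       (FAnds (map (phi_cond (Z :: Zs ++ Y :: av)) (agg_cond E)))) in
  let a := @AAgg (agg_name E) (Z, Zs)
    (freshS_uniq (size (agg_tuple E).2) (Y :: av)) C in
  FEx Y (FAnd (FRel (agg_rel E) a (AVar Y)) (FIn (AVar Y) (rhs_term (agg_rhs E)))).

Definition phi_conjunct (av Xs : seq (var S)) (B : conjunct) : formula :=
  match B with
  | BCond c => phi_cond av c
  | BAgg E => phi_agg av Xs E
  end.

Definition phi_body (av Xs : seq (var S)) (Bs : seq conjunct) : formula :=
  FAnds (map (phi_conjunct av Xs) Bs).

(* The formula representing [R] is [rule_ante V R -> rule_cons V R], where [V]
   are the new variables for the head; they play no role for a constraint. *)
Definition rule_ante (V : seq (var S)) (R : rule) : formula :=
  let Phi := phi_body (V ++ rule_vars R) (local_vars R) (body R) in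
  match head R with
  | HBasic A => FAnd (FIns V A.2) Phi
  | HChoice A =>
      FAnd (FIns V A.2) (FAnd Phi (FAtom A.1 (map AVar V)))
  | HNone => Phi
  end.

Definition rule_cons (V : seq (var S)) (R : rule) : formula :=
  match head R with
  | HBasic A => FAtom A.1 (map AVar V)
  | HChoice A => FAtom A.1 (map AVar V)
  | HNone => FBot
  end.

Definition rule_repr (V : seq (var S)) (R : rule) : formula :=
  FImp (rule_ante V R) (rule_cons V R).

Definition defines (p : sym S) (n : nat) (R : rule) : bool :=
  has (fun A : atom => (A.1 == p) && (size A.2 == n)) (head_atoms (head R)).

Definition completed_definition (l : seq rule) (p : sym S) (n : nat) : formula :=
  let V := freshn n (flatten (map rule_vars l)) in
  let Fs := [seq rule_ante V R | R <- l & defines p n R] in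
  FAlls V (FIff (FAtom p (map AVar V))
    (FOrs [seq FExs (undup [seq x <- free_vars F | x \notin V]) F | F <- Fs])).

Definition completion (l : seq rule) : set formula :=
  [set F | (exists p n, occurs (program_of l) p n /\
                        F = completed_definition l p n) \/
           (exists R, [/\ List.In R l, head R = HNone &
                          F = universal_closure (rule_repr [::] R)])].

(* The sets of formulas under infinitary conjunctions and disjunctions are given
   as families indexed by arbitrary types. *)

Inductive iform : Type :=
| IAtom of patom
| IBot
| IConj (T : Type) of (T -> iform)
| IDisj (T : Type) of (T -> iform)
| IImp of iform & iform.

Definition INeg F := IImp F IBot.
Definition ITop := INeg IBot.
Definition IOr F G := IDisj (fun b : bool => if b then F else G).
Definition conj_over (T : Type) (P : set T) (F : T -> iform) :=
  IConj (fun x : {x : T | P x} => F (sval x)).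
Definition disj_over (T : Type) (P : set T) (F : T -> iform) :=
  IDisj (fun x : {x : T | P x} => F (sval x)).

Fixpoint isat (I : set patom) (F : iform) : Prop :=
  match F with
  | IAtom A => I A
  | IBot => False
  | IConj T G => forall i : T, isat I (G i)
  | IDisj T G => exists i : T, isat I (G i)
  | IImp G H => isat I G -> isat I H
  end.

Fixpoint reduct (I : set patom) (F : iform) : iform :=
  if `[< isat I F >] then
    match F with
    | IAtom A => IAtom A
    | IBot => IBot
    | IConj T G => IConj (fun i : T => reduct I (G i))
    | IDisj T G => IDisj (fun i : T => reduct I (G i))
    | IImp G H => IImp (reduct I G) (reduct I H)
    end
  else IBot.

Definition istable (F : iform) (I : set patom) : Prop :=
  isat I (reduct I F) /\
  forall J : set patom, J `<=` I -> isat J (reduct I F) -> J = I.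

End Syntax.

Arguments TNum {S} _.
Arguments TInf {S}.
Arguments TSup {S}.
Arguments PNum {S} _.
Arguments PInf {S}.
Arguments PSup {S}.
Arguments HNone {S}.
Arguments FBot {S}.
Arguments FTop {S}.
Arguments ANum {S} _.
Arguments AInf {S}.
Arguments ASup {S}.
Arguments IBot {S}.
Arguments ITop {S}.
Arguments subst_empty {S}.

(* The total order on precomputed terms and the functions attached to the
   aggregate names. *)
Record semantics (S : signature) := Semantics {
  ple : rel (pterm S);
  ple_anti : antisymmetric ple;
  ple_trans : transitive ple;
  ple_total : total ple;
  ple_inf : forall r, ple PInf r;
  ple_sup : forall r, ple r PSup;
  ple_num : forall m n : int, ple (PNum m) (PNum n) = (m <= n)%R;
  agg_fun : aggname S -> set (ntuple (pterm S)) -> pterm S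
}.

Section Semantics.
Variables (S : signature) (D : semantics S).

Definition rel_holds (q : relsym) (r1 r2 : pterm S) : Prop :=
  match q with
  | REq => r1 = r2
  | RNeq => r1 <> r2
  | RLt => ple D r1 r2 /\ r1 <> r2
  | RGt => ple D r2 r1 /\ r1 <> r2
  | RLe => ple D r1 r2
  | RGe => ple D r2 r1
  end.

(* Instead of being carried out at each binder, the substitutions of precomputed
   terms for bound variables are accumulated in [s]: [truth I s F] is the truth value of the result of
    applying [s] to [F]. Only closed results are meaningful; a variable left
    unsubstituted gets a dummy value. *)

Fixpoint truth (I : set (patom S)) (s : substitution S) (F : formula S) : Prop :=
  match F with
  | FAtom p args => I (p, map (arg_value I s) args)
  | FRel q a1 a2 => rel_holds q (arg_value I s a1) (arg_value I s a2)
  | FIn a t => values (term_subst s t) (arg_value I s a)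
  | FBot => False
  | FImp F G => truth I s F -> truth I s G
  | FAll x F => forall r : pterm S, truth I (subst_upd s [:: x] [:: r]) F
  end
with arg_value (I : set (patom S)) (s : substitution S) (a : arg S) : pterm S :=
  match a with
  | ANum k => PNum k
  | ASym c => PSym c
  | AVar x => odflt PInf (s x)
  | AInf => PInf
  | ASup => PSup
  | AFun f a args => PFun f (arg_value I s a) (map (arg_value I s) args)
  | AAgg al Xs _ F =>
      agg_fun D al
        [set r : ntuple (pterm S) | size r.2 = size Xs.2 /\
           truth I (subst_upd s (ntuple_seq Xs) (ntuple_seq r)) F]
  end.

Definition satisfies (I : set (patom S)) (T : set (formula S)) : Prop :=
  forall F, T F -> truth I subst_empty F.

(* The translation tau is meaningful for ground conditions, closed aggregate
   expressions and closed rules. *)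

Definition tau_cond (c : condition S) : iform S :=
  match c with
  | CLit (LPos A) =>
      disj_over (tuple_values (@values S) A.2) (fun r => IAtom (A.1, r))
  | CLit (LNeg A) =>
      disj_over (tuple_values (@values S) A.2) (fun r => INeg (IAtom (A.1, r)))
  | CCmp q t1 t2 =>
      if `[< exists r1 r2, [/\ values t1 r1, values t2 r2 & rel_holds q r1 r2] >]
      then ITop else IBot
  end.

Definition tau_conds (C : seq (condition S)) : iform S :=
  conj_over [set c | List.In c C] tau_cond.

Section Aggregate.
Variable E : aggexp S.

Let X : seq (var S) := undup (agg_vars E).
Let A : set (seq (pterm S)) := [set r | size r = size X].
Let sub (r : seq (pterm S)) := subst_upd subst_empty X r.

Definition delta_tuples (Delta : set (seq (pterm S))) : set (ntuple (pterm S)) :=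
  [set v | exists2 r, Delta r &
     tuple_values (@values S)
       (map (term_subst (sub r)) (ntuple_seq (agg_tuple E))) (ntuple_seq v)].

Definition justifies (Delta : set (seq (pterm S))) : Prop :=
  exists2 u, agg_rhs E = RPre u &
    rel_holds (agg_rel E) (agg_fun D (agg_name E) (delta_tuples Delta)) u.

Definition tau_agg : iform S :=
  conj_over [set Delta | Delta `<=` A /\ ~ justifies Delta] (fun Delta =>
    IImp
      (conj_over Delta (fun r => tau_conds (map (cond_subst (sub r)) (agg_cond E))))
      (disj_over (A `\` Delta)
         (fun r => tau_conds (map (cond_subst (sub r)) (agg_cond E))))).

End Aggregate.

Definition tau_conjunct (B : conjunct S) : iform S :=
  match B with
  | BCond c => tau_cond c
  | BAgg E => tau_agg E
  end.

Definition tau_body (Bs : seq (conjunct S)) : iform S :=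
  conj_over [set B | List.In B Bs] tau_conjunct.

Definition tau_rule (R : rule S) : iform S :=
  match head R with
  | HBasic A =>
      IImp (tau_body (body R))
        (conj_over (tuple_values (@values S) A.2) (fun r => IAtom (A.1, r)))
  | HChoice A =>
      IImp (tau_body (body R))
        (conj_over (tuple_values (@values S) A.2)
           (fun r => IOr (IAtom (A.1, r)) (INeg (IAtom (A.1, r)))))
  | HNone => INeg (tau_body (body R))
  end.

Definition tau_program (Gamma : program S) : iform S :=
  conj_over [set R' | exists2 R, Gamma R & is_instance R R'] tau_rule.

Definition stable_model (Gamma : program S) (I : set (patom S)) : Prop :=
  I `<=` vocabulary Gamma /\ istable (tau_program Gamma) I.

End Semantics.

(* Main.v *)
(* Every element [A] of a stable model [I] is supported by a rule instance whose
   body holds in [I] and whose head has [A] among its values: if there were none,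
   [I] minus [A] would still satisfy the reduct. For the instance of a rule given
   by an assignment of its global variables, the translation of the body holds
   in [I] exactly when the formula representing the body is true under that
   assignment. *)
Require Import Defs.
From mathcomp Require Import all_boot order ssralg ssrnum ssrint.
From mathcomp Require Import boolp classical_sets.
Set Implicit Arguments.
Unset Strict Implicit.
Unset Printing Implicit Defensive.
Local Open Scope classical_set_scope.

(** * Membership in mapped and filtered lists *)

Lemma mem_flatten_map_In (T : Type) (U : eqType) (f : T -> seq U) (l : seq T)
    (a : T) (x : U) :
  List.In a l -> x \in f a -> x \in flatten (map f l).
Proof.
elim: l => //= b l IHl [->|al] xa; rewrite mem_cat ?xa //.
by rewrite (IHl al xa) orbT.
Qed.

Lemma In_map (T U : Type) (f : T -> U) (l : seq T) (b : U) :
  List.In b (map f l) <-> exists2 a, List.In a l & b = f a.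
Proof.
elim: l => /= [|c l IHl]; first by split=> // -[].
split=> [[<-|/IHl[a al ->]]|[a [<-|al] ba]].
- by exists c => //; left.
- by exists a => //; right.
- by left.
- by right; apply/IHl; exists a.
Qed.

Lemma In_filter (T : Type) (P : pred T) (l : seq T) (a : T) :
  List.In a (filter P l) <-> List.In a l /\ P a.
Proof.
elim: l => /= [|c l IHl]; first by split=> // -[].
case Pc: (P c) => /=; split.
- case=> [<-|al]; [by split=> //; left|].
  by have [aL Pa] := proj1 IHl al; split=> //; right.
- by case=> -[->|al] Pa; [left|right; apply/IHl].
- by case/IHl=> al Pa; split=> //; right.
- by case=> -[ca|al] Pa; [rewrite ca Pa in Pc|apply/IHl].
Qed.

(** * Substitutions, values and variables of terms *)

Section Terms.
Variable S : signature.
Implicit Types (s g h : substitution S) (t : term S) (r : pterm S).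

Lemma freshn_notin n (av : seq (var S)) x : x \in freshn n av -> x \notin av.
Proof. by have /andP[_ /allP] := freshn_uniq n av; apply. Qed.

Lemma size_freshn n (av : seq (var S)) : size (freshn n av) = n.
Proof. by elim: n av => //= n IHn av; rewrite IHn. Qed.

(** The generated induction principle gives no hypothesis for the terms inside the list of [TFun];
    the [foldr] conjunction supplies it, by an inner induction on that list. *)
Lemma term_nested_ind (P : term S -> Prop) :
  (forall k, P (TNum k)) -> (forall c, P (TSym c)) -> (forall x, P (TVar x)) ->
  P TInf -> P TSup ->
  (forall f t ts, P t -> foldr (fun u => and (P u)) True ts -> P (TFun f t ts)) ->
  (forall o ts, (forall i, P (ts i)) -> P (@TOp S o ts)) ->
  (forall t1 t2, P t1 -> P t2 -> P (TInt t1 t2)) ->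
  forall t, P t.
Proof.
move=> Pnum Psym Pvar Pinf Psup Pfun Pop Pint; fix IH 1.
case=> [k|c|x|||f t ts|o ts|t1 t2].
- exact: Pnum.
- exact: Psym.
- exact: Pvar.
- exact: Pinf.
- exact: Psup.
- apply: Pfun; first exact: (IH t).
  by elim: ts => [//|u ts IHts] /=; split; first exact: (IH u).
- by apply: Pop => i; exact: (IH (ts i)).
- by apply: Pint; [exact: (IH t1)|exact: (IH t2)].
Qed.

Lemma pterm_nested_ind (P : pterm S -> Prop) :
  (forall k, P (PNum k)) -> (forall c, P (PSym c)) -> P PInf -> P PSup ->
  (forall f r rs, P r -> foldr (fun u => and (P u)) True rs -> P (PFun f r rs)) ->
  forall r, P r.
Proof.
move=> Pnum Psym Pinf Psup Pfun; fix IH 1.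
case=> [k|c|||f r rs].
- exact: Pnum.
- exact: Psym.
- exact: Pinf.
- exact: Psup.
- apply: Pfun; first exact: (IH r).
  by elim: rs => [//|u rs IHrs] /=; split; first exact: (IH u).
Qed.

Lemma term_subst_eq s s' t :
  {in term_vars t, s =1 s'} -> term_subst s t = term_subst s' t.
Proof.
elim/term_nested_ind: t => //=.
- by move=> x ->; rewrite ?mem_head.
- move=> f t ts IHt IHts ss'; rewrite IHt; last first.
    by move=> x xt; apply: ss'; rewrite mem_cat xt.
  have {ss'}: {in flatten (map (@term_vars S) ts), s =1 s'}.
    by move=> x xt; apply: ss'; rewrite mem_cat xt orbT.
  move=> ss'; congr TFun; elim: ts IHts ss' => //= u ts IH [IHu /IH{}IH] ss'.
  by rewrite IHu ?IH // => x xt; apply: ss'; rewrite mem_cat xt ?orbT.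
- move=> o ts IHts ss'; congr TOp; apply/funext => i; apply: IHts => x xi.
  apply: ss'; apply/flattenP; exists (term_vars (ts i)) => //.
  by apply: (map_f (fun i => term_vars (ts i))); rewrite mem_enum.
- move=> t1 t2 IH1 IH2 ss'.
  by rewrite IH1 ?IH2 // => x xt; apply: ss'; rewrite mem_cat xt ?orbT.
Qed.

Lemma map_term_subst_eq s s' (ts : seq (term S)) :
  {in tuple_vars ts, s =1 s'} -> map (term_subst s) ts = map (term_subst s') ts.
Proof.
elim: ts => //= t ts IHts ss'.
by rewrite (@term_subst_eq s s') ?IHts // => x xt;
  apply: ss'; rewrite mem_cat xt ?orbT.
Qed.

Lemma cond_subst_eq s s' c :
  {in cond_vars c, s =1 s'} -> cond_subst s c = cond_subst s' c.
Proof.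
case: c => /= [[] [p ts] /= ss'|q t1 t2 ss'].
- by rewrite /atom_subst /= (map_term_subst_eq ss').
- by rewrite /atom_subst /= (map_term_subst_eq ss').
- by rewrite !(@term_subst_eq s s') // => x xt;
    apply: ss'; rewrite mem_cat xt ?orbT.
Qed.

Lemma term_subst_term_of s r : term_subst s (term_of r) = term_of r.
Proof.
elim/pterm_nested_ind: r => //= f r rs -> IHrs; congr TFun.
by elim: rs IHrs => //= u rs IH [-> /IH->].
Qed.

Lemma term_vars_term_of r : term_vars (term_of r) = [::].
Proof.
elim/pterm_nested_ind: r => //= f r rs -> IHrs.
by elim: rs IHrs => //= u rs IH [-> /IH].
Qed.

Lemma values_term_of r : values (term_of r) = [set r].
Proof.
elim/pterm_nested_ind: r => //= f r rs -> IHrs.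
have -> : tuple_values (@values S) (map (@term_of S) rs) = [set rs].
  elim: rs IHrs => //= u rs IH [-> /IH->]; apply/seteqP; split=> v /=.
    by case=> ? -> [? -> <-].
  by move=> ->; exists u => //; exists rs.
by apply/seteqP; split=> v /= => [[? -> [? -> <-]]|->] //; exists r => //; exists rs.
Qed.

Lemma size_tuple_values (A B : Type) (V : A -> set B) (ts : seq A) (rs : seq B) :
  tuple_values V ts rs -> size rs = size ts.
Proof. by elim: ts rs => /= [rs ->|t ts IH rs [u _ [us /IH <- <-]]]. Qed.

(** First [g], then [h]: the values of [g] are precomputed and unchanged by [h], so composition
    reduces to giving priority to [g]. *)
Definition subst_comp g h : substitution S :=
  fun x => if g x is Some r then Some r else h x.

Lemma term_subst_comp g h t :
  term_subst h (term_subst g t) = term_subst (subst_comp g h) t.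
Proof.
elim/term_nested_ind: t => //=.
- by move=> x; rewrite /subst_comp; case: (g x) => //= r; rewrite term_subst_term_of.
- by move=> f t ts -> IHts; congr TFun; elim: ts IHts => //= u ts IH [-> /IH->].
- by move=> o ts IHts; congr TOp; apply/funext.
- by move=> t1 t2 -> ->.
Qed.

Lemma map_term_subst_comp g h (ts : seq (term S)) :
  map (term_subst h) (map (term_subst g) ts) = map (term_subst (subst_comp g h)) ts.
Proof. by elim: ts => //= t ts ->; rewrite term_subst_comp. Qed.

Lemma cond_subst_comp g h c :
  cond_subst h (cond_subst g c) = cond_subst (subst_comp g h) c.
Proof.
case: c => /= [[] [p ts]|q t1 t2] /=.
- by rewrite /atom_subst /= map_term_subst_comp.
- by rewrite /atom_subst /= map_term_subst_comp.
- by rewrite !term_subst_comp.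
Qed.

Lemma term_vars_subst g t x :
  x \in term_vars t -> g x = None -> x \in term_vars (term_subst g t).
Proof.
move=> + gx; elim/term_nested_ind: t => //=.
- by move=> y; rewrite inE => /eqP <-; rewrite gx mem_head.
- move=> f t ts IHt IHts; rewrite !mem_cat => /orP[/IHt->//|xts].
  apply/orP; right; elim: ts IHts xts => //= u ts IH [IHu /IH{}IH].
  by rewrite !mem_cat => /orP[/IHu->//|/IH->]; rewrite orbT.
- move=> o ts IHts /flattenP[_ /mapP[i ie ->] /IHts xi].
  apply/flattenP; exists (term_vars (term_subst g (ts i))) => //.
  exact: (map_f (fun i => term_vars (term_subst g (ts i)))).
- by move=> t1 t2 IH1 IH2; rewrite !mem_cat => /orP[/IH1->|/IH2->] //; rewrite orbT.
Qed.

Lemma tuple_vars_subst g (ts : seq (term S)) x :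
  x \in tuple_vars ts -> g x = None -> x \in tuple_vars (map (term_subst g) ts).
Proof.
move=> + gx; elim: ts => //= t ts IHts.
rewrite !mem_cat => /orP[/term_vars_subst->//|/IHts].
by rewrite /tuple_vars => ->; rewrite orbT.
Qed.

Lemma cond_vars_subst g c x :
  x \in cond_vars c -> g x = None -> x \in cond_vars (cond_subst g c).
Proof.
case: c => /= [[] [p ts]|q t1 t2] /=; try exact: tuple_vars_subst.
by rewrite !mem_cat => /orP[] /term_vars_subst xt /xt->; rewrite ?orbT.
Qed.

(** [tau_agg] ranges over tuples for the variables of the aggregate expression after instantiation;
    this guarantees that the local variables of its left-hand part are still among them. *)
Lemma agg_left_vars_subst g E x :
  x \in agg_left_vars E -> g x = None -> x \in agg_left_vars (agg_subst g E).
Proof.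
move=> xE gx; rewrite /agg_left_vars mem_cat in xE.
rewrite /agg_left_vars mem_cat; case/orP: xE => [xt|xC]; apply/orP; [left|right].
  exact: (tuple_vars_subst xt gx).
case: E xC => al ts C q u /= xC.
elim: C xC => //= c C IHC; rewrite !mem_cat.
by case/orP=> [/cond_vars_subst->|/IHC->] //; rewrite orbT.
Qed.

End Terms.

(** * Evaluation of connectives, quantifier blocks and memberships *)

Section Truth.
Variables (S : signature) (D : semantics S) (I : set (patom S)).
Implicit Types (s g : substitution S) (F G : formula S) (xs : seq (var S)).

Local Notation truth := (truth D I).

Lemma truth_and s F G : truth s (FAnd F G) <-> truth s F /\ truth s G.
Proof.
split=> /= [FG|[sF sG]]; last by apply.
by split; apply: contrapT => nF; apply: FG => // ? ?.
Qed.

Lemma truth_or s F G : truth s (FOr F G) <-> truth s F \/ truth s G.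
Proof.
split=> /= [FG|[sF nF|sG _] //].
by case: (pselect (truth s F)) => [|/FG]; [left|right].
Qed.

Lemma truth_iff s F G : truth s (FIff F G) <-> (truth s F <-> truth s G).
Proof. by rewrite truth_and. Qed.

Lemma truth_ex s x F :
  truth s (FEx x F) <-> exists r, truth (subst_upd s [:: x] [:: r]) F.
Proof.
split=> /= [sF|[r rF]]; last by move/(_ r rF).
by apply: contrapT => nF; apply: sF => r rF; apply: nF; exists r.
Qed.

Lemma truth_ands (T : Type) s (f : T -> formula S) (l : seq T) :
  truth s (FAnds (map f l)) <-> forall a, List.In a l -> truth s (f a).
Proof.
elim: l => [|b l IHl]; first by split=> //= _ [].
rewrite truth_and IHl; split=> [[fb fl] a [<-//|/fl//]|H].
by split=> [|a al]; apply: H; [left|right].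
Qed.

Lemma truth_ors (T : Type) s (f : T -> formula S) (l : seq T) :
  truth s (FOrs (map f l)) <-> exists2 a, List.In a l & truth s (f a).
Proof.
elim: l => [|b l IHl]; first by split=> //= -[].
rewrite truth_or IHl; split=> [[fb|[a al fa]]|[a [<-|al] fa]].
- by exists b => //; left.
- by exists a => //; right.
- by left.
- by right; exists a.
Qed.

(** The substitutions reachable from [s] through a block of quantifiers over [xs]. Describing the
    result rather than the successive updates makes order and repetitions in [xs] immaterial. *)
Definition reassigns xs s s' :=
  (forall x, x \notin xs -> s' x = s x) /\ (forall x, x \in xs -> isSome (s' x)).

Lemma reassigns_nil s s' : reassigns [::] s s' -> s' = s.
Proof. by case=> ss' _; apply/funext => x; apply: ss'. Qed.

Lemma reassigns_cons x xs s s' :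
  reassigns (x :: xs) s s' <->
  exists r, reassigns xs (subst_upd s [:: x] [:: r]) s'.
Proof.
split=> [[out inn]|[r [out inn]]].
  (* The intermediate value chosen for [x] is its final one, which is correct even if [x] recurs in
     [xs]. *)
  have := inn x (mem_head _ _); case sx: (s' x) => [r|//] _; exists r; split.
    move=> y yxs; rewrite /subst_upd inE; case: eqP => [->|/eqP yx] /=.
      by rewrite eqxx sx.
    by rewrite out // inE negb_or yx.
  by move=> y yxs; rewrite inn // inE yxs orbT.
split=> y; rewrite inE ?negb_or.
  by case/andP=> yx yxs; rewrite out // /subst_upd inE (negPf yx).
case yxs: (y \in xs); first by rewrite inn.
rewrite orbF => /eqP yx; rewrite out ?yxs // /subst_upd yx mem_head //=.
Qed.

Lemma reassigns_refl s : reassigns [::] s s.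
Proof. by split. Qed.

Lemma reassigns_upd s xs rs : reassigns xs s (subst_upd s xs rs).
Proof. by split=> x; rewrite /subst_upd; [move/negPf->|move->]. Qed.

Lemma truth_alls xs s F :
  truth s (FAlls xs F) <-> forall s', reassigns xs s s' -> truth s' F.
Proof.
elim: xs s => [|x xs IHxs] s.
  split=> [sF s' /reassigns_nil->//|]; apply; exact: reassigns_refl.
split=> /= [sF s' /reassigns_cons[r rs']|sF r].
  by apply: (proj1 (IHxs _) (sF r)).
by apply/IHxs => s' rs'; apply/sF/reassigns_cons; exists r.
Qed.

Lemma truth_exs xs s F :
  truth s (FExs xs F) <-> exists2 s', reassigns xs s s' & truth s' F.
Proof.
elim: xs s => [|x xs IHxs] s.
  split=> [sF|[s' /reassigns_nil-> //]]; by exists s => //; apply: reassigns_refl.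
rewrite truth_ex; split=> [[r /IHxs[s' rs' sF]]|[s' /reassigns_cons[r rs'] sF]].
  by exists s' => //; apply/reassigns_cons; exists r.
by exists r; apply/IHxs; exists s'.
Qed.

(** Agrees with [arg_value] on variables, including the dummy value [PInf] of an unassigned one. *)
Definition var_value s x : pterm S := odflt PInf (s x).

Lemma map_var_value_upd s xs rs :
  uniq xs -> size rs = size xs -> map (var_value (subst_upd s xs rs)) xs = rs.
Proof.
move=> uxs srs; apply: (@eq_from_nth _ PInf); rewrite size_map // => i ixs.
case: xs uxs srs ixs => // x0 xs uxs srs ixs.
by rewrite (nth_map x0) // /var_value /subst_upd mem_nth // index_uniq.
Qed.

Lemma arg_value_vars s xs :
  map (arg_value D I s) (map (@AVar S) xs) = map (var_value s) xs.
Proof. by rewrite -map_comp. Qed.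

Lemma truth_ins s xs (ts : seq (term S)) : size xs = size ts ->
  truth s (FIns xs ts) <->
  tuple_values (@values S) (map (term_subst s) ts) (map (var_value s) xs).
Proof.
rewrite /FIns; elim: ts xs => [|t ts IHts] [|x xs] //.
  by move=> _; split=> // _ [].
move=> [/IHts{}IHts]; rewrite truth_and IHts.
split=> [[xt xts]|[r rt [rs rts [rx rsx]]]].
  by exists (var_value s x) => //; exists (map (var_value s) xs).
by rewrite -rsx; split=> //=; rewrite -/(var_value s x) -rx.
Qed.

Lemma subst_upd_eq s s' xs rs (ys : seq (var S)) :
  {in [seq y <- ys | y \notin xs], s =1 s'} ->
  {in ys, subst_upd s xs rs =1 subst_upd s' xs rs}.
Proof.
move=> ss' y yys; rewrite /subst_upd; case: ifPn => // yxs.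
by apply: ss'; rewrite mem_filter yxs.
Qed.

(** The recursion is mutual because aggregate arguments contain formulas. Propositions are equated,
    not merely shown equivalent, so that the sets of tuples passed to [agg_fun] become equal. *)
Fixpoint truth_eq F {struct F} : forall s s',
    {in free_vars F, s =1 s'} -> truth s F = truth s' F
with arg_value_eq (a : arg S) {struct a} : forall s s',
    {in arg_free_vars a, s =1 s'} -> arg_value D I s a = arg_value D I s' a.
Proof.
- case: F => [p args|q a1 a2|a t||F G|x F] s s' ss' /=.
  + congr (I (p, _)); move: ss' => /=.
    elim: args => //= a args IH ss'.
    rewrite (arg_value_eq a s s') ?IH // => x xa; apply: ss';
      by rewrite mem_cat xa ?orbT.
  + by rewrite (arg_value_eq a1 s s') ?(arg_value_eq a2 s s') // => x xa;
      apply: ss'; rewrite mem_cat xa ?orbT.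
  + by rewrite (arg_value_eq a s s') ?(@term_subst_eq _ s s') // => x xa;
      apply: ss'; rewrite mem_cat xa ?orbT.
  + by [].
  + by rewrite (truth_eq F s s') ?(truth_eq G s s') // => x xa;
      apply: ss'; rewrite mem_cat xa ?orbT.
  + apply: eq_forall => r; apply: truth_eq; apply: subst_upd_eq => y.
    by rewrite mem_filter inE => ?; apply: ss'; rewrite mem_filter.
- case: a => [k|c|x|||f a args|al Xs u F] s s' ss' //=.
  + by rewrite ss' ?mem_head.
  + rewrite (arg_value_eq a s s'); last by move=> x xa; apply: ss'; rewrite mem_cat xa.
    have {ss'}: {in flatten (map (@arg_free_vars S) args), s =1 s'}.
      by move=> x xa; apply: ss'; rewrite mem_cat xa orbT.
    move=> ss'; congr PFun; elim: args ss' => //= b args IH ss'.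
    by rewrite (arg_value_eq b s s') ?IH // => x xa; apply: ss';
      rewrite mem_cat xa ?orbT.
  + congr agg_fun; apply/funext => r /=.
    rewrite (truth_eq F _ (subst_upd s' (ntuple_seq Xs) (ntuple_seq r))) //.
    exact: subst_upd_eq.
Qed.


(** * Formula representations of bodies against the translation [tau] *)

Lemma reassigns_fresh xs s s' (ys : seq (var S)) :
  {in ys, forall x, x \notin xs} -> reassigns xs s s' -> {in ys, s' =1 s}.
Proof. by move=> xsys [ss' _] x /xsys/ss'. Qed.

(** The new variables avoid [av], so assigning them leaves the terms of [c] unchanged; their values
    are then exactly the tuple that selects a disjunct of [tau_cond]. *)
Lemma truth_phi_cond s (av : seq (var S)) c : {subset cond_vars c <= av} ->
  truth s (phi_cond av c) <-> isat I (tau_cond D (cond_subst s c)).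
Proof.
have freshP n (ys : seq (var S)) : {subset ys <= av} ->
    {in ys, forall x, x \notin freshn n av}.
  by move=> sub x /sub; apply: contraL => /freshn_notin.
(* Positive and negative literals are treated together: [P] is membership of the atom in [I] or its
   negation. *)
have literal (ts : seq (term S)) (F : formula S) (P : set (seq (pterm S))) :
    {subset tuple_vars ts <= av} ->
    (forall s', truth s' F <-> P (map (var_value s') (freshn (size ts) av))) ->
    truth s (FExs (freshn (size ts) av) (FAnd (FIns (freshn (size ts) av) ts) F))
    <-> exists2 r, tuple_values (@values S) (map (term_subst s) ts) r & P r.
  move=> sub FP; rewrite truth_exs; split.
    case=> s' rs' /truth_and[/truth_ins + /FP PF]; rewrite size_freshn => /(_ erefl) v.
    exists (map (var_value s') (freshn (size ts) av)) => //.
    rewrite (@map_term_subst_eq _ s s') // => x xts.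
    by rewrite (reassigns_fresh (freshP _ _ sub) rs').
  case=> r rts Pr; have sr : size r = size (freshn (size ts) av).
    by rewrite (size_tuple_values rts) size_map size_freshn.
  have /andP[un _] := freshn_uniq (size ts) av.
  exists (subst_upd s (freshn (size ts) av) r); first exact: reassigns_upd.
  rewrite truth_and truth_ins ?size_freshn // FP map_var_value_upd //; split=> //.
  rewrite (@map_term_subst_eq _ (subst_upd s _ r) s) // => x xts.
  exact: (reassigns_fresh (freshP _ _ sub) (reassigns_upd s _ r)).
case: c => [[] [p ts]|q t1 t2] sub; rewrite /phi_cond.
- rewrite /= (literal _ _ (fun r => I (p, r))) //; last first.
    by move=> s'; rewrite /= arg_value_vars.
  by split=> [[r rts Ir]|[[r rts] Ir]]; [exists (exist _ r rts) | exists r].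
- rewrite /= (literal _ _ (fun r => ~ I (p, r))) //; last first.
    by move=> s'; rewrite /= arg_value_vars.
  by split=> [[r rts Ir]|[[r rts] Ir]]; [exists (exist _ r rts) | exists r].
(* The two quantified variables of the comparison are, by computation, the list [freshn 2 av]. *)
- rewrite (truth_exs (freshn 2 av)) [tau_cond _ _]/=.
  have st s' : reassigns (freshn 2 av) s s' ->
      (term_subst s' t1 = term_subst s t1) * (term_subst s' t2 = term_subst s t2).
    move=> rs'; split; apply: term_subst_eq; apply: reassigns_fresh rs';
      by apply: freshP => x xt; apply: sub; rewrite mem_cat xt ?orbT.
  have -> P : isat I (if `[< P >] then ITop else IBot) <-> P.
    by case: asboolP => // nP; split=> // _ [].
  split=> [[s' rs']|[r1 [r2 [v1 v2 r12]]]].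
    rewrite !truth_and /= !st // => -[v1 [v2 r12]].
    by exists (var_value s' (fresh av)), (var_value s' (fresh (fresh av :: av))).
  have /andP[un _] := freshn_uniq 2 av.
  have rs' := reassigns_upd s (freshn 2 av) [:: r1; r2].
  exists (subst_upd s (freshn 2 av) [:: r1; r2]) => //.
  have [e1 e2] := map_var_value_upd s un (erefl : size [:: r1; r2] = size _).
  by rewrite !truth_and /= !st // -!/(var_value _ _) e1 e2.
Qed.


Lemma isat_conj_over (T : Type) (P : set T) (f : T -> iform S) :
  isat I (conj_over P f) <-> forall a, P a -> isat I (f a).
Proof. by split=> [H a Pa|H [a Pa]]; [apply: (H (exist _ a Pa))|apply: H]. Qed.

Lemma isat_disj_over (T : Type) (P : set T) (f : T -> iform S) :
  isat I (disj_over P f) <-> exists2 a, P a & isat I (f a).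
Proof.
by split=> [[[a Pa] fa]|[a Pa fa]]; [exists a | exists (exist _ a Pa)].
Qed.

Lemma isat_imp (J : set (patom S)) (F G : iform S) :
  isat J (IImp F G) = (isat J F -> isat J G).
Proof. by []. Qed.

(** The only [Delta] whose implication in [tau_agg] can fail in [I]: its antecedent holds and no
    disjunct of its consequent does. *)
Definition true_tuples (E : aggexp S) : set (seq (pterm S)) :=
  let X := undup (agg_vars E) in
  [set r | size r = size X /\ forall c, List.In c (agg_cond E) ->
     isat I (tau_cond D (cond_subst (subst_upd subst_empty X r) c))].

(* Any other [Delta] makes its implication true: its antecedent forces
   [Delta `<=` true_tuples E], and a strict inclusion gives a disjunct. *)
Lemma isat_tau_agg (E : aggexp S) :
  isat I (tau_agg D E) <-> justifies D E (true_tuples E).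
Proof.
set X := undup (agg_vars E).
have condsP r : isat I (tau_conds D
      (map (cond_subst (subst_upd subst_empty X r)) (agg_cond E))) <->
    forall c, List.In c (agg_cond E) ->
      isat I (tau_cond D (cond_subst (subst_upd subst_empty X r) c)).
  rewrite isat_conj_over; split=> [H c cE|H _ /In_map[c cE ->]]; last exact: H.
  by apply: H; apply/In_map; exists c.
rewrite /tau_agg isat_conj_over; split=> [H|just Delta [DX njust]].
  apply: contrapT => njust.
  have := H (true_tuples E) (conj (fun r rE => proj1 rE) njust).
  rewrite isat_imp isat_conj_over isat_disj_over; case.
    by move=> r [_ rE]; apply/condsP.
  by move=> r [rX nr] /condsP rE; apply: nr.
rewrite isat_imp isat_conj_over isat_disj_over => DE.
apply: contrapT => nE; apply: njust; suff -> : Delta = true_tuples E by [].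
apply/seteqP; split=> r => [Dr|[rX rE]].
  by split; [exact: DX|apply/condsP; exact: DE].
apply: contrapT => nDr; apply: nE; exists r; first by split.
exact/condsP.
Qed.

(** Once substituted, the right-hand side is a precomputed term and has itself as its only value, so
    the existential variable of [phi_agg] is forced to be that term. *)
Lemma rel_agg_rhs s u (q : relsym) v :
  (forall x, x \in rhs_vars u -> isSome (s x)) ->
  (exists y, rel_holds D q v y /\ values (term_subst s (rhs_term u)) y) <->
  (exists2 w, rhs_subst s u = RPre w & rel_holds D q v w).
Proof.
case: u => [x|w] /= su; last first.
  rewrite term_subst_term_of values_term_of.
  by split=> [[y [qy /= <-]]|[y [<-] ?]]; [exists y | exists w].
have := su x (mem_head _ _); case: (s x) => // w _.
rewrite values_term_of.
by split=> [[y [qy /= <-]]|[y [<-] ?]]; [exists y | exists w].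
Qed.

(* [Xs] lists the local variables of the rule containing [E], [g] produces the
   instance of the rule, and [s] extends [g]. *)
Lemma truth_phi_agg s g (av Xs : seq (var S)) (E : aggexp S) :
  {subset agg_vars E <= av} -> {subset Xs <= av} ->
  (forall x, x \in rhs_vars (agg_rhs E) -> x \notin Xs) ->
  (forall x, x \in agg_vars E ->
     if x \in Xs then g x = None else isSome (g x) /\ g x = s x) ->
  truth s (phi_agg av Xs E) <-> isat I (tau_agg D (agg_subst g E)).
Proof.
move=> Eav Xav rhsX gs.
rewrite isat_tau_agg /phi_agg truth_ex /justifies.
set Y := fresh av; set Z := fresh (Y :: av).
set Zs := freshn _ _.
set C := FExs _ _.
have rhsE x : x \in rhs_vars (agg_rhs E) -> isSome (g x) /\ g x = s x.
  move=> xu; have := gs x; rewrite /agg_vars mem_cat xu orbT (negPf (rhsX x xu)).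
  exact.
have -> : agg_rhs (agg_subst g E) = rhs_subst g (agg_rhs E) by [].
rewrite -rel_agg_rhs; last by move=> x /rhsE[].
have ZZsav x : x \in av -> (x \notin Z :: Zs) /\ (x != Y).
  move=> xav; split; last by apply: contraTneq xav => ->; apply: fresh_notin.
  apply: contraTN xav => xZ.
  have : x \notin Y :: av by apply: (@freshn_notin _ (size (agg_tuple E).2).+1).
  by rewrite inE negb_or => /andP[].
have leftE x : x \in agg_left_vars E -> x \in agg_vars E.
  by move=> xE; rewrite /agg_vars mem_cat xE.
set E' := agg_subst g E; set X := undup (agg_vars E').
(* If [s'] acts on the left-hand part as the instance by [g] followed by the tuple [r], the formula
   inside the aggregate says that [r] satisfies the conditions and yields the values of
   [Z :: Zs]. *)
have bodyP s' r :
    {in agg_left_vars E, s' =1 subst_comp g (subst_upd subst_empty X r)} ->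
    truth s' (FAnd (FIns (Z :: Zs) (ntuple_seq (agg_tuple E)))
       (FAnds (map (phi_cond (Z :: Zs ++ Y :: av)) (agg_cond E)))) <->
    tuple_values (@values S)
      (map (term_subst (subst_upd subst_empty X r)) (ntuple_seq (agg_tuple E')))
      (map (var_value s') (Z :: Zs)) /\
    forall c, List.In c (agg_cond E') ->
      isat I (tau_cond D (cond_subst (subst_upd subst_empty X r) c)).
  move=> s'r.
  have tE : {in tuple_vars (ntuple_seq (agg_tuple E)),
      s' =1 subst_comp g (subst_upd subst_empty X r)}.
    by move=> x xt; apply: s'r; rewrite /agg_left_vars mem_cat xt.
  have cE c : List.In c (agg_cond E) -> {subset cond_vars c <= agg_left_vars E}.
    move=> cE x xc; rewrite /agg_left_vars mem_cat.
    by rewrite (mem_flatten_map_In cE xc) orbT.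
  have -> : ntuple_seq (agg_tuple E') =
    map (term_subst g) (ntuple_seq (agg_tuple E)) by [].
  rewrite truth_and truth_ins; last by rewrite /= size_freshn.
  rewrite map_term_subst_comp (map_term_subst_eq tE) truth_ands.
  have condP c : List.In c (agg_cond E) ->
      truth s' (phi_cond (Z :: Zs ++ Y :: av) c) <->
      isat I (tau_cond D (cond_subst (subst_upd subst_empty X r) (cond_subst g c))).
    move=> cC; rewrite truth_phi_cond => [|x /(cE _ cC)/leftE/Eav xav]; last first.
      by rewrite inE mem_cat inE xav !orbT.
    rewrite cond_subst_comp.
    rewrite (@cond_subst_eq _ s' (subst_comp g (subst_upd subst_empty X r))) //.
    by move=> x /(cE _ cC)/s'r.
  split=> -[tv H]; split=> // c cC; last first.
    by apply/condP => //; apply: H; apply/In_map; exists c.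
  by move: cC => /In_map[c' c'E ->]; apply/condP => //; apply: H.
(* With [rel_agg_rhs] handling the right-hand side, it remains to see that both aggregates are
   applied to the same set of tuples. *)
suff aggE y : arg_value D I (subst_upd s [:: Y] [:: y])
    (@AAgg _ (agg_name E) (Z, Zs) (freshS_uniq (size (agg_tuple E).2) (Y :: av)) C) =
    agg_fun D (agg_name E') (delta_tuples E' (true_tuples E')).
  have YE y : term_subst (subst_upd s [:: Y] [:: y]) (rhs_term (agg_rhs E)) =
      term_subst g (rhs_term (agg_rhs E)).
    apply: term_subst_eq => x xt.
    have xu : x \in rhs_vars (agg_rhs E).
      by case: (agg_rhs E) xt => //= u; rewrite term_vars_term_of.
    have /ZZsav[_ xY] : x \in av by apply: Eav; rewrite /agg_vars mem_cat xu orbT.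
    by rewrite /subst_upd inE (negPf xY); have [_ ->] := rhsE x xu.
  have yE y : arg_value D I (subst_upd s [:: Y] [:: y]) (AVar Y) = y.
    by rewrite /= /subst_upd mem_head /= eqxx.
  have FRelE s' q a b : truth s' (FRel q a b) =
    rel_holds D q (arg_value D I s' a) (arg_value D I s' b) by [].
  have FInE s' a t : truth s' (FIn a t) =
    values (term_subst s' t) (arg_value D I s' a) by [].
  split=> -[y].
    by rewrite truth_and FRelE FInE aggE YE yE => -[]; exists y.
  by case=> qy yu; exists y; rewrite truth_and FRelE FInE aggE YE yE.
have ZZsX : {in Z :: Zs, forall x, x \notin Xs}.
  by move=> x; apply: contraTN => /Xav/ZZsav[].
have ZZsE s' v : size v.2 = size Zs ->
    reassigns Xs (subst_upd (subst_upd s [:: Y] [:: y]) (Z :: Zs) (ntuple_seq v)) s' ->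
    map (var_value s') (Z :: Zs) = ntuple_seq v.
  move=> sv rs'; have sv' : size (ntuple_seq v) = size (Z :: Zs) by rewrite /= sv.
  rewrite -[RHS](map_var_value_upd (subst_upd s [:: Y] [:: y]) (freshS_uniq _ _) sv').
  apply/eq_in_map => x xZ; congr odflt; exact: (reassigns_fresh ZZsX rs').
rewrite [LHS]/=; congr agg_fun; apply/seteqP; split=> v.
- case=> /= sv /truth_exs[s' rs' s'C].
  (* The tuple in [true_tuples E'] is read off [s'] along [X], the variables of the instantiated
     expression. *)
  have sub_r x : subst_upd subst_empty X (map (var_value s') X) x =
      if x \in X then Some (var_value s' x) else None.
    rewrite /subst_upd; case: ifP => // xX; congr Some.
    by rewrite (nth_map x) ?index_mem // nth_index.
  have [] := proj1 (bodyP s' (map (var_value s') X) _) s'C.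
    move=> x xl; rewrite /subst_comp; have := gs x (leftE x xl).
    have [inn out] := rs'; case: ifPn => [xXs gx|xXs [gx gxs]].
      rewrite gx sub_r mem_undup; have := out x xXs.
      rewrite /agg_vars mem_cat (agg_left_vars_subst xl gx) /var_value.
      by case: (s' x).
    rewrite inn // /subst_upd; have /Eav/ZZsav[/negPf-> /negPf xY] := leftE x xl.
    by rewrite inE xY -gxs; case: (g x) gx.
  rewrite (ZZsE _ _ sv rs') => vt condE.
  by exists (map (var_value s') X) => //; split=> //; rewrite size_map.
- case=> r [sr condE] vt; have sv : size v.2 = size Zs.
    by have := size_tuple_values vt; rewrite size_map /= size_map size_freshn => -[].
  split=> //; rewrite truth_exs.
  pose s1 := subst_upd (subst_upd s [:: Y] [:: y]) (Z :: Zs) (ntuple_seq v).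
  (* Conversely, local variables take their values from [r]. Those in [Xs] but outside [X] do not
     occur in the left-hand part of [E], so the dummy [PInf] does no harm. *)
  pose s' : substitution S := fun x =>
    if x \in Xs then Some (var_value (subst_upd subst_empty X r) x) else s1 x.
  have rs' : reassigns Xs s1 s'.
    by split=> x xXs; rewrite /s'; [rewrite (negPf xXs)|rewrite xXs].
  exists s' => //; apply/(bodyP s' r); last by rewrite (ZZsE _ _ sv rs').
  move=> x xl; rewrite /subst_comp /s'; have := gs x (leftE x xl).
  case: ifPn => [xXs gx|xXs [gx gxs]].
    rewrite gx /var_value /subst_upd mem_undup.
    by rewrite /agg_vars mem_cat (agg_left_vars_subst xl gx).
  rewrite /s1 /subst_upd; have /Eav/ZZsav[/negPf-> /negPf xY] := leftE x xl.
  by rewrite inE xY -gxs; case: (g x) gx.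
Qed.


Definition instance_subst (R : rule S) (r : var S -> pterm S) : substitution S :=
  fun x => if x \in global_vars R then Some (r x) else None.

(** Conjunct by conjunct: variables of conditions and right-hand sides of aggregates are global,
    hence fixed by [r], while the remaining variables of aggregates are local and left open by
    [instance_subst]. *)
Lemma truth_phi_body (V : seq (var S)) (R : rule S) r s :
  {in global_vars R, forall x, s x = Some (r x)} ->
  truth s (phi_body (V ++ rule_vars R) (local_vars R) (body R)) <->
  isat I (tau_body D (map (conjunct_subst (instance_subst R r)) (body R))).
Proof.
move=> sr; rewrite truth_ands isat_conj_over.
have bodyR B : List.In B (body R) -> {subset conjunct_vars B <= rule_vars R}.
  by move=> BR x xB; rewrite /rule_vars mem_cat (mem_flatten_map_In BR xB) orbT.
have localE x : (x \in local_vars R) = (x \notin global_vars R) && (x \in rule_vars R).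
  by rewrite mem_undup mem_filter.
have conjunctP B : List.In B (body R) ->
    truth s (phi_conjunct (V ++ rule_vars R) (local_vars R) B) <->
    isat I (tau_conjunct D (conjunct_subst (instance_subst R r) B)).
  move=> BR; have Bav : {subset conjunct_vars B <= V ++ rule_vars R}.
    by move=> x xB; rewrite mem_cat (bodyR B BR x xB) orbT.
  have globalB x : x \in match B with BCond c => cond_vars c
      | BAgg E => rhs_vars (agg_rhs E) end -> x \in global_vars R.
    move=> xB; rewrite /global_vars mem_cat; apply/orP; right.
    exact: (mem_flatten_map_In (f := fun B => match B with BCond c => cond_vars c
      | BAgg E => rhs_vars (agg_rhs E) end) BR xB).
  case: B BR Bav globalB => [c|E] BR Bav globalB.
    rewrite truth_phi_cond // (@cond_subst_eq _ s (instance_subst R r)) // => x.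
    by move=> /globalB xR; rewrite /instance_subst xR sr.
  apply: truth_phi_agg => // x.
  - by rewrite localE => /andP[_ xR]; rewrite mem_cat xR orbT.
  - by move=> /globalB; rewrite localE => ->.
  - move=> xE; rewrite localE (bodyR _ BR) // andbT /instance_subst.
    by case: ifPn; [move/negPf->|rewrite negbK => xR; rewrite xR sr].
split=> [H _ /In_map[B BR ->]|H B BR]; first by apply/conjunctP => //; apply: H.
by apply/conjunctP => //; apply: H; apply/In_map; exists B.
Qed.

(** * Reducts and support of atoms in stable models *)

Lemma isat_reduct J (F : iform S) : isat J (reduct I F) -> isat I F.
Proof. by case: F => [A||T G|T G|G H] /=; case: asboolP. Qed.

Lemma reduct_sat (F : iform S) : isat I F -> reduct I F = match F with
    | IAtom A => IAtom A
    | IBot => IBot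
    | IConj T G => IConj (fun i => reduct I (G i))
    | IDisj T G => IDisj (fun i => reduct I (G i))
    | IImp G H => IImp (reduct I G) (reduct I H)
    end.
Proof. by case: F => [A||T G|T G|G H] sF; rewrite /reduct asboolT. Qed.

Lemma reduct_imp (F G : iform S) : isat I (IImp F G) ->
  reduct I (IImp F G) = IImp (reduct I F) (reduct I G).
Proof. exact: reduct_sat. Qed.

Lemma reduct_conj_over J (T : Type) (P : set T) (f : T -> iform S) :
  isat I (conj_over P f) ->
  isat J (reduct I (conj_over P f)) <-> forall a, P a -> isat J (reduct I (f a)).
Proof.
move=> sF; rewrite (reduct_sat sF).
by split=> [H a Pa|H [a Pa]]; [apply: (H (exist _ a Pa))|apply: H].
Qed.

Lemma stable_sat (F : iform S) : istable F I -> isat I F.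
Proof. by case=> /isat_reduct. Qed.

(** If [A] is outside [I], the reduct of its negation is [IBot] implying [IBot], which every set
    satisfies; otherwise the first disjunct reduces to [A] itself. *)
Lemma isat_head_reduct J A : J `<=` I -> (I A -> J A) ->
  isat J (reduct I (IOr (IAtom A) (INeg (IAtom A)))).
Proof.
move=> JI IJ; have sA : isat I (IOr (IAtom A) (INeg (IAtom A))).
  by case: (pselect (I A)) => IA; [exists true|exists false].
rewrite (reduct_sat sA); case: (pselect (I A)) => IA.
  by exists true; rewrite reduct_sat //; exact: IJ.
by exists false; rewrite reduct_sat //= asboolF.
Qed.

(* Otherwise [I] minus the atom would satisfy the reduct. *)
Lemma stable_supported (Gamma : seq (rule S)) A :
  istable (tau_program D (program_of Gamma)) I -> I A ->
  exists R r B, [/\ List.In R Gamma, Defs.head R = HBasic B \/ Defs.head R = HChoice B,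
    B.1 = A.1, tuple_values (@values S)
      (map (term_subst (instance_subst R r)) B.2) A.2 &
    isat I (tau_body D (map (conjunct_subst (instance_subst R r)) (body R)))].
Proof.
move=> st IA; apply: contrapT => unsupported.
have sI := stable_sat st; case: st => _ /(_ (I `\ A)) min.
have JI : I `\ A `<=` I by apply: subDsetl.
(* Minimality would make [I] without [A] equal to [I]. *)
suff /(min JI) IE : isat (I `\ A) (reduct I (tau_program D (program_of Gamma))).
  by move: IA; rewrite -IE => -[_]; apply.
apply/reduct_conj_over => // R' RR'.
have {sI} : isat I (tau_rule D R') by apply: (proj1 (isat_conj_over _ _) sI).
case: RR' => R RG [r]; rewrite -/(instance_subst R r) => ->.
(* Since [A] is unsupported, removing it touches no head value of an instance whose body holds in
   [I]. *)
have notA B t : Defs.head R = HBasic B \/ Defs.head R = HChoice B ->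
    isat I (tau_body D (map (conjunct_subst (instance_subst R r)) (body R))) ->
    tuple_values (@values S) (map (term_subst (instance_subst R r)) B.2) t ->
    I (B.1, t) -> (I `\ A) (B.1, t).
  move=> RB bodyI vt IB; split=> //= EA; apply: unsupported.
  by exists R, r, B; rewrite -EA.
rewrite /tau_rule; set Body := tau_body D _.
have -> : Defs.head (rule_subst (instance_subst R r) R) =
  head_subst (instance_subst R r) (Defs.head R) by [].
(* A body whose reduct holds in the smaller set holds in [I] by [isat_reduct], so the instance
   yields its head in [I], or a contradiction if it is a constraint. *)
case Rhead: (Defs.head R) => [B|B|] sR;
  rewrite (reduct_imp sR) isat_imp => /isat_reduct bodyI //.
- apply/reduct_conj_over => [|t vt]; first exact: sR.
  have It : I (B.1, t) := sR bodyI (exist _ t vt).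
  by rewrite reduct_sat //; apply: notA bodyI vt It; left.
- apply/reduct_conj_over => [|t vt]; first exact: sR.
  apply: isat_head_reduct => // It.
  by apply: notA bodyI vt It; right.
- by have := sR bodyI.
Qed.

(** * Truth of constraints and completed definitions *)

Lemma truth_rule_ante (V : seq (var S)) (R : rule S) B r s :
  Defs.head R = HBasic B \/ Defs.head R = HChoice B -> size V = size B.2 ->
  {in global_vars R, forall x, s x = Some (r x)} ->
  truth s (rule_ante V R) <->
  [/\ tuple_values (@values S) (map (term_subst (instance_subst R r)) B.2)
         (map (var_value s) V),
      isat I (tau_body D (map (conjunct_subst (instance_subst R r)) (body R))) &
      Defs.head R = HChoice B -> I (B.1, map (var_value s) V)].
Proof.
move=> RB sV sr; rewrite -(propext (truth_phi_body V sr)).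
(* Head variables are global, so [s] and the instance agree on the head terms. *)
have headR : {subset tuple_vars B.2 <= global_vars R}.
  move=> x xB; rewrite /global_vars mem_cat /head_vars.
  by case: RB => -> /=; rewrite cats0 xB.
have -> : map (term_subst (instance_subst R r)) B.2 = map (term_subst s) B.2.
  by apply: map_term_subst_eq => x /headR xR; rewrite /instance_subst xR sr.
rewrite -(propext (truth_ins s sV)) /rule_ante.
(* The last condition is vacuous for a basic rule; for a choice rule it is the extra conjunct of the
   antecedent. *)
case: RB => ->; rewrite !truth_and; first by split=> [[]|[]].
split=> [[vV [bodyI IV]]|[vV bodyI IV]]; split=> //.
  by move=> _; rewrite -arg_value_vars.
by split=> //=; rewrite arg_value_vars; apply: IV.
Qed.

Lemma isat_tau_instance (Gamma : seq (rule S)) R r :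
  isat I (tau_program D (program_of Gamma)) -> List.In R Gamma ->
  isat I (tau_rule D (rule_subst (instance_subst R r) R)).
Proof. by move=> /isat_conj_over sI RG; apply: sI; exists R => //; exists r. Qed.

Lemma truth_universal_closure (F : formula S) :
  (forall r, truth (fun x => Some (r x)) F) ->
  truth subst_empty (universal_closure F).
Proof.
move=> tF; apply/truth_alls => s [_ sF].
rewrite (@truth_eq F s (fun x => Some (var_value s x))) // => x xF.
by rewrite /var_value; have := sF x; rewrite mem_undup => /(_ xF); case: (s x).
Qed.

Lemma truth_constraint (Gamma : seq (rule S)) R :
  isat I (tau_program D (program_of Gamma)) -> List.In R Gamma ->
  Defs.head R = HNone -> truth subst_empty (universal_closure (rule_repr [::] R)).
Proof.
move=> sI RG Rhead; apply: truth_universal_closure => r.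
rewrite /rule_repr /rule_ante /rule_cons Rhead => bodyI.
have := isat_tau_instance r sI RG; rewrite /tau_rule /= Rhead; apply.
exact: (proj1 (truth_phi_body [::] _) bodyI).
Qed.

Lemma global_vars_sub (R : rule S) : {subset global_vars R <= rule_vars R}.
Proof.
move=> x; rewrite /global_vars /rule_vars !mem_cat => /orP[->//|xR].
apply/orP; right; elim: (body R) xR => //= B Bs IHBs; rewrite !mem_cat.
case/orP=> [xB|/IHBs->]; last by rewrite orbT.
by case: B xB => /= [c ->|E xE] //; rewrite /agg_vars mem_cat xE orbT.
Qed.

(** Left to right is support. Right to left uses only that a stable model satisfies [tau_program]: a
    basic rule then derives the atom, and the antecedent of a choice rule already contains it. *)
Lemma truth_completed_definition (Gamma : seq (rule S)) p n :
  istable (tau_program D (program_of Gamma)) I ->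
  truth subst_empty (completed_definition Gamma p n).
Proof.
move=> st; apply/truth_alls; set V := freshn n _ => s [_ sV].
have Vrule R x : List.In R Gamma -> x \in V -> x \notin global_vars R.
  move=> RG /freshn_notin; apply: contra => xR.
  exact: mem_flatten_map_In RG (global_vars_sub xR).
rewrite truth_iff truth_ors [truth _ (FAtom _ _)]/= arg_value_vars.
set t := map (var_value s) V.
have definesP R B : Defs.head R = HBasic B \/ Defs.head R = HChoice B ->
    defines p n R = (B.1 == p) && (size B.2 == n).
  by rewrite /defines; case=> -> /=; rewrite orbF.
split=> [IA|[F /In_map[R /In_filter[RG Rdef] ->] /truth_exs[s' [out inn] tR]]].
- have [R [r [B [RG RB Bp vt bodyI]]]] := stable_supported st IA.
  have sB : size B.2 = n.
    by have := size_tuple_values vt; rewrite /= !size_map size_freshn.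
  exists (rule_ante V R).
    apply/In_map; exists R => //; apply/In_filter; split=> //.
    by rewrite (definesP _ _ RB) Bp sB !eqxx.
  (* One assignment serves both the head tuple [V] and the rule: [V] avoids the global variables, so
     overriding [r] on [V] gives the same instance. *)
  pose r' x := if x \in V then var_value s x else r x.
  pose s' : substitution S := fun x => Some (r' x).
  set U := undup _.
  apply/truth_exs; exists (fun x => if x \in U then s' x else s x).
    by split=> x xU; [rewrite (negPf xU)|rewrite xU].
  rewrite (@truth_eq _ _ s') => [|x xF]; last first.
    rewrite mem_undup mem_filter xF andbT /s' /r' /var_value; case: ifPn => //.
    by rewrite negbK => xV; rewrite xV; have := sV x xV; case: (s x).
  have s'V : map (var_value s') V = t.
    by apply/eq_in_map => x xV; rewrite /var_value /s' /r' /= xV.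
  have rr' : instance_subst R r = instance_subst R r'.
    apply/funext => x; rewrite /instance_subst /r'; case: ifPn => // xR.
    by case: ifPn => // /(Vrule R x RG); rewrite xR.
  apply/(truth_rule_ante (r := r') RB) => //; first by rewrite size_freshn.
  rewrite s'V -rr'; split=> // _; by rewrite Bp.
- pose r := var_value s'.
  have s'V x : x \in V -> s' x = s x.
    by move=> xV; apply: out; rewrite mem_undup mem_filter xV.
  (* Each free variable of the antecedent lies in [V] or is quantified, so [s'] is defined on it and
     may be replaced by a total assignment. *)
  have {tR} : truth (fun x => Some (r x)) (rule_ante V R).
    rewrite -(@truth_eq _ s') // => x xF; rewrite /r /var_value.
    have : isSome (s' x).
      case xV: (x \in V); first by rewrite s'V // sV.
      by apply: inn; rewrite mem_undup mem_filter xV.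
    by case: (s' x).
  have [B RB] : exists B, Defs.head R = HBasic B \/ Defs.head R = HChoice B.
    by move: Rdef; rewrite /defines; case: (Defs.head R) => [B|B|] //= _;
      exists B; [left|right].
  move: Rdef; rewrite (definesP _ _ RB) => /andP[/eqP <- /eqP sB].
  have -> : t = map (var_value (fun x => Some (r x))) V.
    by apply/eq_in_map => x xV; rewrite /r /var_value /= s'V.
  move/(truth_rule_ante (r := r) RB) => []//; first by rewrite size_freshn.
  move=> vt bodyI; have := isat_tau_instance r (stable_sat st) RG.
  rewrite /tau_rule /=; case: RB => Rhead; rewrite Rhead; last by move=> _; apply.
  by move=> /(_ bodyI) IB _; apply: (IB (exist _ _ vt)).
Qed.

End Truth.

Theorem theorem1 (S : signature) (D : semantics S) (Gamma : seq (rule S))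
    (I : set (patom S)) :
  stable_model D (program_of Gamma) I -> satisfies D I (completion Gamma).
Proof.
move=> [_ st] F [[p [n [_ ->]]]|[R [RG Rhead ->]]].
  exact: truth_completed_definition.
exact: truth_constraint (stable_sat st) RG Rhead.
Qed.
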